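(* Let $E\subset\mathbb R^2$ be a Lalley-Gatzouras set with data $m$, $(n_i)$, $(b_i)$, $(a_{ij})$, $(c_{ij})$. Then $E$ is uniformly disconnected if and only if $E$ is totally disconnected and there exists an $i\in\{1,2,\dots,m\}$ such that $n_i=0$.
   Context: Lalley-Gatzouras sets. Let $m\ge 2$ and $n_i\ge 0$ ($i=1,\dots,m$) be integers. Let $b_i>0$ ($i=1,\dots,m$) be real numbers with $\sum_{i=1}^m b_i=1$. Put $d_1=0$ and $d_i=b_1+\dots+b_{i-1}$ for $2\le i\le m$. Let $\mathcal D=\{(i,j): 1\le i\le m,\ n_i>0,\ 1\le j\le n_i\}$, assumed nonempty. Let $(a_{ij})_{(i,j)\in\mathcal D}$ and $(c_{ij})_{(i,j)\in\mathcal D}$ be nonnegative real numbers such that $1>b_i>a_{ij}>0$ for each $(i,j)\in\mathcal D$; $\sum_{j=1}^{n_i}a_{ij}\le 1$ for each $i$; $c_{i(j+1)}-c_{ij}\ge a_{ij}$ whenever $(i,j),(i,j+1)\in\mathcal D$; and $1-c_{in_i}\ge a_{in_i}$ for each $i$ with $n_i>0$. For $(i,j)\in\mathcal D$ define $S_{ij}:\mathbb R^2\to\mathbb R^2$ by $S_{ij}(x,y)=(a_{ij}x+c_{ij},\,b_iy+d_i)$. The Lalley-Gatzouras set $E$ is the attractor of $\{S_{ij}\}_{(i,j)\in\mathcal D}$, i.e. the unique nonempty compact set with $E=\bigcup_{(i,j)\in\mathcal D}S_{ij}(E)$. Uniform disconnectedness. A subset $E$ of a metric space is uniformly disconnected if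 there is a constant $C>1$ such that for each $\xi\in E$ and each $r>0$ there is a subset $A\subset E$ with $B(\xi,r/C)\cap E\subset A\subset B(\xi,r)$ and $\operatorname{dist}(A,E\setminus A)\ge r/C$, where $B(\xi,r)$ is the ball of center $\xi$ and radius $r$, $\operatorname{dist}(A_1,A_2)$ is the infimum of distances between points of $A_1$ and $A_2$, and the last condition is considered satisfied when $E\setminus A=\emptyset$. *)

(* Defs.v *)
From HB Require Import structures.
From mathcomp Require Import all_boot all_order all_algebra.
From mathcomp Require Import all_classical all_reals all_analysis.
From mathcomp Require Import ring lra.
Set Implicit Arguments.
Unset Strict Implicit.
Unset Printing Implicit Defensive.
Import Order.TTheory GRing.Theory Num.Theory.
Local Open Scope classical_set_scope.
Local Open Scope ring_scope.

(* R^2 as a metric space. The product [R * R] cannot be used directly: its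
   canonical pseudometric structure is the one of the sup distance. *)
Definition euclidean_plane (R : realType) : Type := (R * R)%type.

Section EuclideanPlane.
Variable R : realType.
Local Notation plane := (euclidean_plane R).

HB.instance Definition _ := Choice.copy plane (R * R)%type.

Definition euclidean_dist (p q : plane) : R :=
  Num.sqrt ((p.1 - q.1) ^+ 2 + (p.2 - q.2) ^+ 2).

Lemma euclidean_distxx p : euclidean_dist p p = 0.
Proof. by rewrite /euclidean_dist !subrr expr0n addr0 sqrtr0. Qed.

Lemma euclidean_dist_positivity p q : euclidean_dist p q = 0 -> p = q.
Proof.
case: p q => [p1 p2] [q1 q2] /eqP; rewrite /euclidean_dist /= sqrtr_eq0 => pq.
have /andP[] : ((p1 - q1) ^+ 2 == 0) && ((p2 - q2) ^+ 2 == 0).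
  by rewrite -paddr_eq0 ?sqr_ge0// eq_le pq addr_ge0 ?sqr_ge0.
by rewrite !sqrf_eq0 !subr_eq0 => /eqP -> /eqP ->.
Qed.

Lemma euclidean_dist_sym p q : euclidean_dist p q = euclidean_dist q p.
Proof. by rewrite /euclidean_dist -sqrrN opprB -[X in _ + X]sqrrN opprB. Qed.

Lemma euclidean_dist_triangle q p r :
  euclidean_dist p r <= euclidean_dist p q + euclidean_dist q r.
Proof.
rewrite /euclidean_dist.
set a := p.1 - q.1; set b := p.2 - q.2.
set c := q.1 - r.1; set d := q.2 - r.2.
have -> : p.1 - r.1 = a + c by rewrite /a /c; ring.
have -> : p.2 - r.2 = b + d by rewrite /b /d; ring.
have ab0 : 0 <= a ^+ 2 + b ^+ 2 by rewrite addr_ge0 ?sqr_ge0.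
have cd0 : 0 <= c ^+ 2 + d ^+ 2 by rewrite addr_ge0 ?sqr_ge0.
have st0 : 0 <= Num.sqrt (a ^+ 2 + b ^+ 2) + Num.sqrt (c ^+ 2 + d ^+ 2).
  by rewrite addr_ge0 ?sqrtr_ge0.
rewrite -[leRHS](ger0_norm st0) -sqrtr_sqr ler_wsqrtr//.
rewrite [leRHS]sqrrD !sqr_sqrtr// -sqrtrM//.
suff : a * c + b * d <= Num.sqrt ((a ^+ 2 + b ^+ 2) * (c ^+ 2 + d ^+ 2)).
  by rewrite mulr2n; nra.
rewrite (le_trans (ler_norm _))// -sqrtr_sqr ler_wsqrtr//.
rewrite -subr_ge0 (_ : _ - _ = (a * d - b * c) ^+ 2) ?sqr_ge0//; ring.
Qed.

HB.instance Definition _ := isMetric.Build R plane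
  euclidean_distxx euclidean_dist_positivity
  euclidean_dist_sym euclidean_dist_triangle.

End EuclideanPlane.

(* Valued in the extended reals: the distance to the empty set is [+oo]. *)
Definition set_dist {R : realType} {T : metricType R} (A B : set T) : \bar R :=
  ereal_inf [set (mdist p.1 p.2)%:E | p in A `*` B].

(* [ball xi r] is the open ball [[set x | mdist xi x < r]] ([ballEmdist]).
   When [E `\` A] is empty, [set_dist A (E `\` A) = +oo] and the last condition
   holds, as it should. *)
Definition uniformly_disconnected {R : realType} {T : metricType R}
    (E : set T) : Prop :=
  exists2 C : R, 1 < C &
    forall (xi : T) (r : R), E xi -> 0 < r ->
      exists A : set T,
        [/\ A `<=` E,
            ball xi (r / C) `&` E `<=` A,
            A `<=` ball xi r &
            ((r / C)%:E <= set_dist A (E `\` A))%E].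

(* Indices start at 0: [i : 'I_m] stands for the row i + 1 and, in this row,
   [j : 'I_(n i)] stands for j + 1. The index set of the maps is the type
   [{i : 'I_m & 'I_(n i)}]; rows with [n i = 0] contribute nothing to it. *)
Record lalley_gatzouras_data {R : realType} (m : nat) (n : 'I_m -> nat)
    (b : 'I_m -> R) (a c : forall i : 'I_m, 'I_(n i) -> R) : Prop := {
  lg_m_ge2 : (2 <= m)%N ;
  lg_b_gt0 : forall i, 0 < b i ;
  lg_b_sum : \sum_(i < m) b i = 1 ;
  lg_nonempty : exists i, (0 < n i)%N ;
  lg_c_ge0 : forall i (j : 'I_(n i)), 0 <= c i j ;
  lg_a_bounds : forall i (j : 'I_(n i)), [/\ b i < 1, a i j < b i & 0 < a i j] ;
  lg_a_sum : forall i, \sum_(j < n i) a i j <= 1 ;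
  lg_c_step : forall i (j k : 'I_(n i)), k = j.+1 :> nat ->
    a i j <= c i k - c i j ;
  lg_c_last : forall i (j : 'I_(n i)), j.+1 = n i -> a i j <= 1 - c i j
}.

Definition lg_d {R : realType} {m : nat} (b : 'I_m -> R) (i : 'I_m) : R :=
  \sum_(k < m | (k < i)%N) b k.

Definition lg_map {R : realType} {m : nat} {n : 'I_m -> nat} (b : 'I_m -> R)
    (a c : forall i : 'I_m, 'I_(n i) -> R) (ij : {i : 'I_m & 'I_(n i)})
    (p : euclidean_plane R) : euclidean_plane R :=
  let i := projT1 ij in let j := projT2 ij in
  (a i j * p.1 + c i j, b i * p.2 + lg_d b i).

Definition is_attractor {T : topologicalType} {I : Type} (S : I -> T -> T)
    (E : set T) : Prop :=
  [/\ E !=set0, compact E & E = \bigcup_(i in [set: I]) (S i @` E)].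

(* Main.v *)
(* If a row is full (its intervals tile [0, 1]) then E contains a horizontal
   segment, so total disconnectedness puts a gap in every row. If no row is
   empty, E projects onto the whole vertical unit interval; since a_ij < b_i, the
   cylinder of a long constant word is then arbitrarily thin compared with its
   height, and cannot be cut at the scale of its height.

   Conversely, an empty row makes the vertical projection of E porous, and the
   gaps in the rows make every horizontal strip (given by a word of row indices)
   porous in the horizontal direction, at all scales above its height because
   widths are smaller than heights. Strips can be adjacent and have unrelated
   horizontal structures, but a window that is thin compared with r is covered
   by two strips of height comparable to its own, which still have a common
   horizontal gap of size comparable to r. A box of width r bounded by such
   horizontal gaps, and of height a small multiple of r and bounded by vertical
   gaps, cuts out the required set A. *)
Require Import Defs.
From HB Require Import structures.
From mathcomp Require Import all_boot all_order all_algebra.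
From mathcomp Require Import all_classical all_reals all_analysis.
From mathcomp Require Import ring lra.
Import Order.TTheory GRing.Theory Num.Theory.
Import numFieldNormedType.Exports.
Local Open Scope classical_set_scope.
Local Open Scope ring_scope.

Set Implicit Arguments.
Unset Strict Implicit.
Unset Printing Implicit Defensive.

(** * Separation and components in a metric space *)

Section MetricSpaces.
Context {R : realType} {T : metricType R}.
Implicit Types (A B E : set T) (x y : T).

Lemma set_dist_geP A B (e : R) :
  (e%:E <= set_dist A B)%E <->
  forall x y, A x -> B y -> e <= mdist x y.
Proof.
split=> [h x y Ax By|h].
  by rewrite -lee_fin (le_trans h)//; apply: ereal_inf_lbound; exists (x, y).
by apply/ereal_infP => _ [[x y] [/= Ax By] <-]; rewrite lee_fin h.
Qed.

Lemma open_thickening A (e : R) : open (\bigcup_(x in A) ball x e).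
Proof.
rewrite openE => y [x Ax]; rewrite ballEmdist /= => xy.
apply/metricType_numDomainType.nbhs_mdistP; exists (e - mdist x y) => /= [|z yz].
  by rewrite subr_gt0.
exists x => //; rewrite ballEmdist /= (le_lt_trans (metric_triangle _ y _))//.
by rewrite addrC -ltrBrDr.
Qed.

(** At scale [mdist x y], for [y <> x] in the component [Q] of [x], the set [A] is clopen in [Q]
    because thickenings separate it from the rest of [E]. So [Q] lies in [A], but [y] does not. *)
Lemma uniformly_disconnected_totally_disconnected E :
  uniformly_disconnected E -> totally_disconnected E.
Proof.
move=> [C C1 hC] x Ex; apply/seteqP; split=> [y Qy|y ->]; last first.
  exact: connected_component_refl.
apply: contrapT => /= yx; set Q := connected_component E x in Qy.
have r0 : 0 < mdist x y by rewrite mdist_gt0; apply/eqP => xy; apply: yx.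
have d0 : 0 < mdist x y / C by rewrite divr_gt0// (lt_trans _ C1).
have [A [AE ballA Aball /set_dist_geP sep]] := hC x _ Ex r0.
set d := mdist x y / C in d0 ballA sep.
have Ax : A x by apply: ballA; split => //; exact: ballxx.
have QE : Q `<=` E by exact: connected_component_sub.
have thickA z : E z -> (\bigcup_(t in A) ball t d) z <-> A z.
  move=> Ez; split => [[t At]|Az]; last by exists z => //; exact: ballxx.
  rewrite ballEmdist /= => tz; apply: contrapT => nAz.
  by have := sep t z At (conj Ez nAz); rewrite leNgt tz.
have thickB z : E z -> (\bigcup_(t in E `\` A) ball t d) z <-> ~ A z.
  move=> Ez; split => [[t At]|Az]; last by exists z => //; exact: ballxx.
  rewrite ballEmdist /= => tz Az.
  by have := sep z t Az At; rewrite metric_sym leNgt tz.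
have QA : Q `&` A = Q.
  apply: (@component_connected _ E x).
  - by exists x; split => //; exact: connected_component_refl.
  - exists (\bigcup_(t in A) ball t d); first exact: open_thickening.
    by apply/seteqP; split=> z [Qz]; have [h1 h2] := thickA _ (QE _ Qz); split; auto.
  - exists (~` \bigcup_(t in E `\` A) ball t d).
      by apply: open_closedC; exact: open_thickening.
    apply/seteqP; split=> z [Qz Az]; have [h1 h2] := thickB _ (QE _ Qz); split => //.
      by move=> /h1.
    by apply: contrapT => /h2.
have /Aball : A y by rewrite -QA in Qy; case: Qy.
by rewrite ballEmdist /= ltxx.
Qed.

End MetricSpaces.

(** * The Euclidean plane *)

Section Plane.
Variable R : realType.
Local Notation plane := (euclidean_plane R).
Implicit Types p q : plane.

Lemma mdist_planeE p q : mdist p q = Num.sqrt ((p.1 - q.1) ^+ 2 + (p.2 - q.2) ^+ 2).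
Proof. by []. Qed.

Lemma mdist_fst p q : `|p.1 - q.1| <= mdist p q.
Proof. by rewrite mdist_planeE -sqrtr_sqr ler_wsqrtr// lerDl sqr_ge0. Qed.

Lemma mdist_snd p q : `|p.2 - q.2| <= mdist p q.
Proof. by rewrite mdist_planeE -sqrtr_sqr ler_wsqrtr// lerDr sqr_ge0. Qed.

Lemma mdist_le_add p q : mdist p q <= `|p.1 - q.1| + `|p.2 - q.2|.
Proof.
have s0 : 0 <= `|p.1 - q.1| + `|p.2 - q.2| by rewrite addr_ge0.
rewrite mdist_planeE -[leRHS](ger0_norm s0) -sqrtr_sqr ler_wsqrtr//.
by rewrite [leRHS]sqrrD !real_normK ?num_real// addrAC lerDl mulrn_wge0// mulr_ge0.
Qed.

Lemma continuous_fst_plane : continuous (fun p : plane => p.1 : R).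
Proof.
move=> p; apply/(@cvgrPdist_lt _ _ _ _ (nbhs_filter p)) => e e0.
apply/metricType_numDomainType.nbhs_mdistP; exists e => //= q /=.
by apply: le_lt_trans; exact: mdist_fst.
Qed.

Lemma continuous_snd_plane : continuous (fun p : plane => p.2 : R).
Proof.
move=> p; apply/(@cvgrPdist_lt _ _ _ _ (nbhs_filter p)) => e e0.
apply/metricType_numDomainType.nbhs_mdistP; exists e => //= q /=.
by apply: le_lt_trans; exact: mdist_snd.
Qed.

Lemma compact_plane_approx (E : set plane) p : compact E ->
  (forall e, 0 < e -> exists q, [/\ E q, `|q.1 - p.1| <= e & `|q.2 - p.2| <= e]) ->
  E p.
Proof.
move=> cE h; have clE : closed E.
  by apply: compact_closed => //; exact: metric_hausdorff.
rewrite (closure_id E).1// => B /metricType_numDomainType.nbhs_mdistP[e /= e0 eB].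
have e4 : 0 < e / 4 by rewrite divr_gt0.
have [q [Eq q1 q2]] := h _ e4; exists q; split=> //; apply: eB => /=.
rewrite metric_sym (le_lt_trans (mdist_le_add _ _))//; lra.
Qed.

Lemma totally_disconnected_no_segment (E : set plane) (y : R) :
  totally_disconnected E -> exists2 x : R, 0 <= x <= 1 & ~ E ((x, y) : plane).
Proof.
move=> tdE; apply: contrapT => h.
have segE (x : R) : 0 <= x <= 1 -> E ((x, y) : plane).
  by move=> x01; apply: contrapT => nE; apply: h; exists x.
pose f (x : R) : plane := (x, y).
have cf : continuous f.
  move=> x; apply/(@metricType_numDomainType.cvgrPdist_lt _ _ _ _ (nbhs_filter x)) => e e0; near=> t.
  rewrite (le_lt_trans (mdist_le_add _ _))//= subrr normr0 addr0.
  by near: t; exact: (@cvgr_dist_lt _ _ _ _ _ id x).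
have := tdE (f 0) (segE 0 _); rewrite lexx ler01 => /(_ isT) E0.
suff : connected_component E (f 0) (f 1).
  by rewrite E0 => -[] /eqP; rewrite oner_eq0.
apply: (@connected_component_max _ _ (f @` `[0, 1])).
- by exists 0 => //=; rewrite in_itv/= lexx ler01.
- by move=> _ [x /= + <-]; rewrite in_itv/=; exact: segE.
- apply: connected_continuous_connected; first exact: segment_connected.
  exact: continuous_subspaceT.
- by exists 1 => //=; rewrite in_itv/= lexx ler01.
Unshelve. all: by end_near.
Qed.

End Plane.

(** * Tilings and porosity on the line *)

Section RealLine.
Variable R : realType.
Implicit Types (F : set R) (x y t g r k L lo : R).

Lemma finite_pos_lower_bound (T : finType) (f : T -> R) :
  (forall i, 0 < f i) -> exists d, [/\ 0 < d, d <= 1 & forall i, d <= f i].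
Proof.
move=> f0; exists (\big[Num.min/1]_i f i); split.
- by apply: lt_bigmin.
- exact: bigmin_le_id.
- by move=> i; exact: bigmin_le.
Qed.

Lemma exists_expr_lt x e : 0 <= x < 1 -> 0 < e -> exists n : nat, x ^+ n < e.
Proof.
move=> /andP[x0 x1] e0; have /cvg_expr : `|x| < 1 by rewrite ger0_norm.
move=> /(@cvgrPdist_lt _ _ _ _ _)/(_ _ e0)[N _ /(_ N (leqnn N))] /=.
by rewrite sub0r normrN ger0_norm ?exprn_ge0//; exists N.
Qed.

(** Going down from the last interval, stop at index 0 or at the first interval whose predecessor
    ends before [y]; it starts no later than [y]. *)
Lemma tiling_cover n (l w : 'I_n -> R) y : (0 < n)%N ->
  (forall j : 'I_n, j = 0 :> nat -> l j <= 0) ->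
  (forall j j' : 'I_n, j' = j.+1 :> nat -> l j' <= l j + w j) ->
  (forall j : 'I_n, j.+1 = n -> 1 <= l j + w j) ->
  0 <= y <= 1 -> exists j, l j <= y <= l j + w j.
Proof.
move=> n0 hl hs hr /andP[y0 y1].
have step (k : nat) (kn : (k < n)%N) :
    y <= l (Ordinal kn) + w (Ordinal kn) -> exists j, l j <= y <= l j + w j.
  elim: k kn => [|k IH] kn yk.
    by exists (Ordinal kn); rewrite yk andbT (le_trans (hl _ _)).
  have kn' := ltnW kn.
  have [/IH//|yk'] := leP y (l (Ordinal kn') + w (Ordinal kn')).
  by exists (Ordinal kn); rewrite yk andbT (le_trans (hs _ _ _) (ltW yk')).
have kn : (n.-1 < n)%N by rewrite prednK.
by apply: (step _ kn); rewrite (le_trans y1)// hr//= prednK.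
Qed.

Definition avoids F t g := forall x, F x -> x <= t \/ t + g <= x.

(* The gap is required to lie in [0, 1], so that it survives when the unit
   interval is mapped onto one of several adjacent intervals. *)
Definition porous F k L lo := forall x r, F x -> lo <= r -> r <= L ->
  exists t, [/\ 0 <= t, x - r <= t, t + k * r <= 1, t + k * r <= x + r
    & avoids F t (k * r)].

(** A scale [r < 1] at a point of copy [j] becomes [r / al j <= L] after zooming. The gap found
    there lies in [[0, 1]], so it is carried into the interval of copy [j], whose interior no other
    copy meets. *)
Lemma porous_step (J : Type) (al ga : J -> R) F F' k L lo lo' amin :
    0 < k -> 0 < amin -> amin * L = 1 ->
    (forall j, amin <= al j) ->
    (forall j, 0 <= ga j) -> (forall j, al j + ga j <= 1) ->
    (forall x, F x -> exists j x', F' x' /\ x = al j * x' + ga j) ->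
    (forall x, F' x -> 0 <= x <= 1) ->
    (forall i j, [\/ i = j, al i + ga i <= ga j | al j + ga j <= ga i]) ->
    (exists t g, [/\ k * L <= g, 0 <= t, t + g <= 1 & avoids F t g]) ->
    (forall j, al j * lo' <= lo) ->
  porous F' k L lo' -> porous F k L lo.
Proof.
move=> k0 am0 amL alm ga0 ga1 FF' F'01 dis [t [g [kLg t0 tg1 tg]]] lolo' poro x r Fx lor rL.
have alp j : 0 < al j by exact: lt_le_trans (alm j).
have al1 j : al j <= 1 by have := ga0 j; have := ga1 j; lra.
have imF y j y' : F' y' -> y = al j * y' + ga j -> ga j <= y <= al j + ga j.
  by move=> /F'01/andP[y0 y1] ->; have a0 := alp j; apply/andP; split; nra.
(* At scales [r >= 1] the window contains [[0, 1]], and the first-level gap is long enough. *)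
have [r1|r1] := leP 1 r.
  exists t; have [j [x' [Fx' xE]]] := FF' _ Fx.
  have /andP[h1 h2] := imF _ _ _ Fx' xE.
  have krg : k * r <= g by rewrite (le_trans _ kLg)// ler_pM2l.
  have := ga0 j; have := ga1 j; split=> //; try lra.
  by move=> y Fy; have [] := tg y Fy; [left|right]; lra.
have [j [x' [Fx' xE]]] := FF' _ Fx; set r' := r / al j.
have rE : r = al j * r' by rewrite mulrC divfK// gt_eqF.
have lo'r' : lo' <= r' by rewrite -(ler_pM2l (alp j)) -rE (le_trans _ lor).
have r'L : r' <= L.
  have r'0 : amin * r' <= amin * L.
    rewrite amL; have [r'0|r'0] := leP 0 r'; last first.
      by rewrite (le_trans _ ler01)// pmulr_rle0// ltW.
    by rewrite (le_trans _ (ltW r1))// rE ler_wpM2r.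
  by rewrite ler_pM2l in r'0.
have [t' [t'0 xt' t'1 t'x av]] := poro x' r' Fx' lo'r' r'L.
have krE : k * r = al j * (k * r') by rewrite rE; ring.
have a0 := alp j; have g0 := ga0 j; have g1 := ga1 j.
exists (al j * t' + ga j); rewrite krE; split.
- by nra.
- by rewrite xE rE; nra.
- by nra.
- by rewrite xE rE; nra.
- move=> y Fy; have [i [y' [Fy' yE]]] := FF' _ Fy.
  have /andP[h3 h4] := imF _ _ _ Fy' yE.
  have [ij|ij|ij] := dis i j.
  + rewrite yE ij; have [] := av y' Fy'; [left|right]; nra.
  + by left; nra.
  + by right; nra.
Qed.

(** If [F] meets the middle half of the window, porosity at radius [r / 4] gives the gap; otherwise
    the middle half is one. *)
Lemma porous_interval F k L lo u r : porous F k L lo -> 0 < k -> k <= 1 ->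
    0 < r -> lo <= r / 4 -> r / 4 <= L ->
  exists t, [/\ u <= t, t + k / 4 * r <= u + r & avoids F t (k / 4 * r)].
Proof.
move=> poro k0 k1 r0 lor rL.
have [[x Fx /andP[xu ux]]|nF] :=
    pselect (exists2 x, F x & u + r / 4 < x < u + r - r / 4).
  have [t [_ h1 _ h2 av]] := poro x _ Fx lor rL.
  have kE : k / 4 * r = k * (r / 4) by ring.
  by exists t; rewrite kE; split=> //; lra.
exists (u + r / 4); have kr : k / 4 * r <= r / 4 by nra.
split; [lra|lra|move=> x Fx].
have [?|xu] := leP x (u + r / 4); [by left|right].
by rewrite leNgt; apply/negP => ux; apply: nF; exists x => //; rewrite xu; lra.
Qed.

End RealLine.

(** * Rows and columns of Lalley-Gatzouras data, and first properties of the attractor *)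

Section LalleyGatzouras.
Context {R : realType} {m : nat} {n : 'I_m -> nat} {b : 'I_m -> R}
  {a c : forall i : 'I_m, 'I_(n i) -> R}.
Hypothesis hdata : lalley_gatzouras_data b a c.
Local Notation plane := (euclidean_plane R).
Local Notation d := (lg_d b).

Let m_ge2 : (2 <= m)%N. Proof. by case: hdata. Qed.
Let b_gt0 i : 0 < b i. Proof. by case: hdata. Qed.
Let a_gt0 i (j : 'I_(n i)) : 0 < a j.
Proof. by have [] := lg_a_bounds hdata j. Qed.
Let a_lt_b i (j : 'I_(n i)) : a j < b i.
Proof. by have [] := lg_a_bounds hdata j. Qed.

Lemma lg_d_ge0 i : 0 <= d i.
Proof. by apply: sumr_ge0 => k _; exact: ltW. Qed.

Lemma lg_dDb i : b i + d i = \sum_(k < m | (k <= i)%N) b k.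
Proof.
rewrite [RHS](bigD1 i) //=; congr (_ + _); apply: eq_bigl => k.
by rewrite ltn_neqAle andbC.
Qed.

Lemma lg_dDb_le1 i : b i + d i <= 1.
Proof.
rewrite lg_dDb -(lg_b_sum hdata) [leRHS](bigID (fun k : 'I_m => (k <= i)%N)) /=.
by rewrite lerDl sumr_ge0// => k _; exact: ltW.
Qed.

Lemma lg_d_step (i k : 'I_m) : (i < k)%N -> b i + d i <= d k.
Proof.
move=> ik; rewrite lg_dDb /lg_d [leRHS](bigID (fun l : 'I_m => (l <= i)%N)) /=.
rewrite (eq_bigl (fun l : 'I_m => (l < k)%N && (l <= i)%N)); last first.
  by move=> l /=; case: (leqP l i) => li; rewrite ?andbF// (leq_ltn_trans li).
by rewrite lerDl sumr_ge0// => l _; exact: ltW.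
Qed.

Lemma lg_rows_nonoverlap (i k : 'I_m) :
  [\/ i = k, b i + d i <= d k | b k + d k <= d i].
Proof.
have [ik|ki|/val_inj ik] := ltngtP i k.
- by apply: Or32; exact: lg_d_step.
- by apply: Or33; exact: lg_d_step.
- exact: Or31.
Qed.

(** [lg_a_bounds] covers nonempty rows only; in general, a second row of positive height takes part
    of [[0, 1]]. *)
Lemma lg_b_lt1 i : b i < 1.
Proof.
have := lg_dDb_le1 i; have := lg_d_ge0 i.
have [k ki] : exists k : 'I_m, k != i.
  have [i0|i0] := eqVneq (i : nat) 0%N.
    by exists (Ordinal m_ge2); rewrite -val_eqE /= i0.
  by exists (Ordinal (ltnW m_ge2)); rewrite -val_eqE /= eq_sym.
have [/eqP|h|h] := lg_rows_nonoverlap k i; first by rewrite (negPf ki).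
  by have := b_gt0 k; have := lg_d_ge0 k; lra.
by have := b_gt0 k; have := lg_dDb_le1 k; lra.
Qed.

Lemma lg_rows_cover y : 0 <= y <= 1 -> exists i, d i <= y <= b i + d i.
Proof.
move=> y01; have [|j j0|j k jk|j jm|i yi] := @tiling_cover _ _ d b y _ _ _ _ y01.
- exact: ltnW.
- by rewrite /lg_d big1// => k; rewrite j0.
- by rewrite addrC lg_dDb /lg_d jk.
- rewrite addrC lg_dDb -(lg_b_sum hdata) le_eqVlt; apply/orP; left; apply/eqP.
  by apply: eq_bigl => k; rewrite -ltnS jm ltn_ord.
by exists i; rewrite addrC.
Qed.

Lemma lg_c_lt i (j k : 'I_(n i)) : (j < k)%N -> a j + c j <= c k.
Proof.
case: k => k /= kn; elim: k kn => // k IH kn; rewrite ltnS leq_eqVlt => /orP[/eqP jk|jk].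
  have /(lg_c_step hdata) : Ordinal kn = j.+1 :> nat by rewrite /= jk.
  by rewrite lerBrDr.
rewrite (le_trans (IH (ltnW kn) jk))//.
have := @lg_c_step _ _ _ _ _ _ hdata i (Ordinal (ltnW kn)) (Ordinal kn) erefl.
by have := a_gt0 (Ordinal (ltnW kn)); lra.
Qed.

Lemma lg_c_le1 i (j : 'I_(n i)) : a j + c j <= 1.
Proof.
have [jn|jn] := eqVneq j.+1 (n i).
  by have := lg_c_last hdata jn; lra.
have n0 : (0 < n i)%N by rewrite (leq_ltn_trans _ (ltn_ord j)).
have ln : ((n i).-1 < n i)%N by rewrite prednK.
have jl : (j < Ordinal ln)%N.
  by rewrite /= -ltnS prednK// ltn_neqAle jn ltn_ord.
have := lg_c_lt jl; have := a_gt0 (Ordinal ln).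
by have := @lg_c_last _ _ _ _ _ _ hdata i (Ordinal ln) (prednK n0); lra.
Qed.

Lemma lg_columns_nonoverlap i (j k : 'I_(n i)) :
  [\/ j = k, a j + c j <= c k | a k + c k <= c j].
Proof.
have [jk|kj|/val_inj jk] := ltngtP j k.
- by apply: Or32; exact: lg_c_lt.
- by apply: Or33; exact: lg_c_lt.
- exact: Or31.
Qed.

Lemma lg_width_lower_bound :
  exists r, [/\ 0 < r, r <= 1, forall i, r <= b i &
    forall i (j : 'I_(n i)), r <= a j].
Proof.
have [r [r0 r1 rb]] := finite_pos_lower_bound b_gt0.
have a0 (ij : {i & 'I_(n i)}) : 0 < a (tagged ij) by [].
have [s [s0 s1 sa]] := finite_pos_lower_bound a0.
exists (Num.min r s); rewrite lt_min r0 s0 ge_min r1; split=> //.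
  by move=> i; rewrite ge_min rb.
by move=> i j; rewrite ge_min (sa (Tagged (fun i => 'I_(n i)) j)) orbT.
Qed.

Lemma lg_height_upper_bound :
  exists r, [/\ 0 <= r, r < 1 & forall i, b i <= r].
Proof.
have b1 i : 0 < 1 - b i by rewrite subr_gt0 lg_b_lt1.
have [r [r0 r1 rb]] := finite_pos_lower_bound b1.
by exists (1 - r); split=> [||i]; [lra|lra|have := rb i; lra].
Qed.

Section Attractor.
Variable E : set plane.
Hypothesis hE : is_attractor (lg_map b a c) E.

Lemma lg_attractor_map i (j : 'I_(n i)) (p : plane) :
  E p -> E ((a j * p.1 + c j, b i * p.2 + d i) : plane).
Proof.
by move=> Ep; case: hE => _ _ ->; exists (Tagged (fun i => 'I_(n i)) j) => //; exists p.
Qed.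

Lemma lg_attractor_inv (p : plane) : E p ->
  exists i (j : 'I_(n i)) (q : plane),
    [/\ E q, p.1 = a j * q.1 + c j & p.2 = b i * q.2 + d i].
Proof. by case: hE => _ _ {1}-> [[i j] _ [q Eq <-]]; exists i, j, q. Qed.

(** An extremal point of the compact [E] is the image of a point of [E] under a contraction
    preserving [[0, 1]] in each coordinate, so the extrema of the coordinates lie in [[0, 1]]. *)
Lemma lg_attractor_unit_square (p : plane) :
  E p -> 0 <= p.1 <= 1 /\ 0 <= p.2 <= 1.
Proof.
have [E0 cE _] := hE => Ep.
have cont1 := continuous_subspaceT (A := E) (@continuous_fst_plane R).
have cont2 := continuous_subspaceT (A := E) (@continuous_snd_plane R).
have [u /set_mem Eu Mu] := compact_EVT_max E0 cE cont1.
have [v /set_mem Ev mv] := compact_EVT_min E0 cE cont1.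
have [w /set_mem Ew Mw] := compact_EVT_max E0 cE cont2.
have [z /set_mem Ez mz] := compact_EVT_min E0 cE cont2.
have [i [j [q [Eq q1 _]]]] := lg_attractor_inv Eu.
have [i' [j' [q' [Eq' q'1 _]]]] := lg_attractor_inv Ev.
have [k [_ [s [Es _ s2]]]] := lg_attractor_inv Ew.
have [k' [_ [s' [Es' _ s'2]]]] := lg_attractor_inv Ez.
have inE q0 : E q0 -> q0 \in E by move=> ?; rewrite inE.
have u1 : u.1 <= 1.
  have := Mu q (inE _ Eq); have := a_gt0 j; have := a_lt_b j; have := lg_b_lt1 i.
  by have := lg_c_le1 j; rewrite q1; nra.
have v0 : 0 <= v.1.
  have := mv q' (inE _ Eq'); have := a_gt0 j'; have := a_lt_b j'; have := lg_b_lt1 i'.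
  by have := lg_c_ge0 hdata j'; rewrite q'1; nra.
have w1 : w.2 <= 1.
  have := Mw s (inE _ Es); have := b_gt0 k; have := lg_b_lt1 k.
  by have := lg_dDb_le1 k; rewrite s2; nra.
have z0 : 0 <= z.2.
  have := mz s' (inE _ Es'); have := b_gt0 k'; have := lg_b_lt1 k'.
  by have := lg_d_ge0 k'; rewrite s'2; nra.
have := Mu p (inE _ Ep); have := mv p (inE _ Ep).
have := Mw p (inE _ Ep); have := mz p (inE _ Ep).
by move=> *; split; apply/andP; split; lra.
Qed.

(** Pull [y] back through a row containing it, approximate there and push forward by a map of this
    nonempty row: each level multiplies the error by at most [r < 1]. *)
Lemma lg_snd_dense y e : (forall i, n i <> 0%N) -> 0 <= y <= 1 -> 0 < e ->
  exists2 p, E p & `|p.2 - y| <= e.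
Proof.
move=> n0 y01 e0; have [r [r0 r1 br]] := lg_height_upper_bound.
have [|N /ltW rN] := @exists_expr_lt _ r e _ e0; first by rewrite r0.
suff [p Ep py] : exists2 p, E p & `|p.2 - y| <= r ^+ N.
  by exists p => //; exact: le_trans rN.
elim: N y y01 {rN} => [|N IH] y y01.
  have [[p Ep] _ _] := hE; exists p => //; rewrite expr0 ler_norml.
  by have [_] := lg_attractor_unit_square Ep; lra.
have [i yi] := lg_rows_cover y01; have bi := b_gt0 i.
have [|p Ep py] := IH ((y - d i) / b i).
  by rewrite divr_ge0 ?ler_pdivrMr ?(ltW bi)//; lra.
have /prednK ni : (0 < n i)%N by rewrite lt0n; apply/eqP.
pose j : 'I_(n i) := cast_ord ni ord0.
exists ((a j * p.1 + c j, b i * p.2 + d i) : plane); first exact: lg_attractor_map.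
have -> : b i * p.2 + d i - y = b i * (p.2 - (y - d i) / b i).
  by field; rewrite gt_eqF.
by rewrite normrM (gtr0_norm bi) exprS ler_pM// ltW.
Qed.

(** If the intervals of row [i] tiled [[0, 1]], then [E] would contain the unit segment at the
    height fixed by this row. *)
Lemma lg_row_gap i : totally_disconnected E ->
  exists t g, [/\ 0 < g, 0 <= t, t + g <= 1
    & forall j : 'I_(n i), a j + c j <= t \/ t + g <= c j].
Proof.
move=> tdE; have [ni|ni] := posnP (n i).
  exists 0, 1; split; rewrite ?add0r// => -[j ji]; exfalso.
  by move: ji; rewrite ni.
apply: contrapT => nogap.
(* Fixed point of the vertical map of row [i], so pulling back in this row moves the abscissa
   only. *)
pose y := d i / (1 - b i).
have bi := b_gt0 i; have bi1 := lg_b_lt1 i.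
have yE : b i * y + d i = y by rewrite /y; field; rewrite gt_eqF// subr_gt0.
have y01 : 0 <= y <= 1.
  rewrite /y divr_ge0 ?lg_d_ge0 ?subr_ge0 ?(ltW bi1)//= ler_pdivrMr ?subr_gt0//.
  by have := lg_dDb_le1 i; lra.
have cover x : 0 <= x <= 1 -> exists j : 'I_(n i), c j <= x <= c j + a j.
  apply: tiling_cover => // [j j0|j k jk|j jn].
  - rewrite leNgt; apply/negP => c0; apply: nogap; exists 0, (c j).
    have aj := a_gt0 j; have cj := lg_c_le1 j.
    split; rewrite ?add0r//; first lra.
    move=> k; right; have [k0|k0] := posnP k.
      by have /val_inj-> : j = k :> nat by rewrite j0 k0.
    by have := @lg_c_lt _ j k; rewrite j0 => /(_ k0); lra.
  - rewrite leNgt; apply/negP => cjk; apply: nogap.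
    exists (a j + c j), (c k - (a j + c j)).
    have cj := lg_c_ge0 hdata j; have aj := a_gt0 j.
    have ak := a_gt0 k; have ck := lg_c_le1 k; split; try lra.
    move=> l; have [lj|jl] := leqP l j.
      left; move: lj; rewrite leq_eqVlt => /orP[/eqP/val_inj->//|/lg_c_lt]; lra.
    right; rewrite addrC subrK.
    move: jl; rewrite -jk leq_eqVlt => /orP[/eqP/val_inj->//|/lg_c_lt].
    by have := a_gt0 k; lra.
  - rewrite leNgt; apply/negP => c1; apply: nogap.
    exists (a j + c j), (1 - (a j + c j)).
    have cj := lg_c_ge0 hdata j; have aj := a_gt0 j; split; try lra.
    move=> l; left; have : (l <= j)%N by rewrite -ltnS jn.
    by rewrite leq_eqVlt => /orP[/eqP/val_inj->//|/lg_c_lt]; lra.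
have [x x01 nE] := totally_disconnected_no_segment y tdE; apply: nE.
(* By closedness, approximation suffices: [x] is pulled back through columns containing it, as in
   [lg_snd_dense]. *)
have [_ cE _] := hE; apply: compact_plane_approx => // e e0 /=.
have [r [r0 r1 br]] := lg_height_upper_bound.
have [|N /ltW rN] := @exists_expr_lt _ r e _ e0; first by rewrite r0.
suff [p [Ep px py]] : exists p, [/\ E p, `|p.1 - x| <= r ^+ N & `|p.2 - y| <= r ^+ N].
  by exists p; split=> //; exact: le_trans rN.
elim: N x x01 {rN} => [|N IH] x x01.
  have [[p Ep] _ _] := hE; exists p; rewrite expr0 !ler_norml.
  by have [] := lg_attractor_unit_square Ep; split=> //; lra.
have [j xj] := cover x x01; have aj := a_gt0 j; have ab := a_lt_b j.
have [|p [Ep px py]] := IH ((x - c j) / a j).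
  by rewrite divr_ge0 ?ler_pdivrMr ?(ltW aj)//; lra.
exists ((a j * p.1 + c j, b i * p.2 + d i) : plane); split => /=.
- exact: lg_attractor_map.
- have -> : a j * p.1 + c j - x = a j * (p.1 - (x - c j) / a j).
    by field; rewrite gt_eqF.
  rewrite normrM (gtr0_norm aj) exprS; apply: ler_pM => //; first exact: ltW.
  by rewrite (le_trans (ltW ab)).
- have -> : b i * p.2 + d i - y = b i * (p.2 - y) by rewrite -{1}yE; ring.
  by rewrite normrM (gtr0_norm bi) exprS ler_pM// ltW.
Qed.

End Attractor.
End LalleyGatzouras.

(** * Necessity of an empty row *)

Section LalleyGatzourasFull.
Context {R : realType} {m : nat} {n : 'I_m -> nat} {b : 'I_m -> R}
  {a c : forall i : 'I_m, 'I_(n i) -> R} {E : set (euclidean_plane R)}.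
Hypothesis hdata : lalley_gatzouras_data b a c.
Hypothesis hE : is_attractor (lg_map b a c) E.
Local Notation plane := (euclidean_plane R).

Lemma lg_cylinder i (j : 'I_(n i)) k : exists x y, forall p : plane, E p ->
  E ((a j ^+ k * p.1 + x, b i ^+ k * p.2 + y) : plane).
Proof.
elim: k => [|k [x [y IH]]].
  by exists 0, 0 => -[p1 p2] Ep; rewrite !expr0 !mul1r !addr0.
exists (a j ^+ k * c j + x), (b i ^+ k * lg_d b i + y) => p Ep.
have := IH _ (lg_attractor_map hE j Ep).
by rewrite /= !mulrDr !mulrA -!exprSr !addrA.
Qed.

(* The cylinder of a constant word of length k has width at most a^k and height
   b^k, where a < b; when no row is empty it meets every horizontal line of its
   height, so that a set A separated at scale b^k from the rest of E contains
   the whole cylinder as soon as it contains its bottom. *)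
Lemma uniformly_disconnected_empty_row :
  uniformly_disconnected E -> exists i : 'I_m, n i = 0%N.
Proof.
move=> [C C1 hC]; apply: contrapT => /forallNP n0.
have C0 : 0 < C := lt_trans ltr01 C1.
pose i : 'I_m := Ordinal (ltnW (lg_m_ge2 hdata)).
have /prednK ni : (0 < n i)%N by rewrite lt0n; apply/eqP.
pose j : 'I_(n i) := cast_ord ni ord0.
have [_ ab a0] := lg_a_bounds hdata j; have b0 := lg_b_gt0 hdata i.
(* Depth at which the width is less than the height over [4 * C]. *)
have [k abk] : exists k, (a j / b i) ^+ k < (4 * C)^-1.
  apply: exists_expr_lt; last by rewrite invr_gt0 mulr_gt0.
  by rewrite divr_ge0 ?(ltW a0) ?(ltW b0)//= ltr_pdivrMr// mul1r.
set w := a j ^+ k; set h := b i ^+ k.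
have h0 : 0 < h by rewrite exprn_gt0.
have w0 : 0 < w by rewrite exprn_gt0.
have wh : w < h * (4 * C)^-1.
  by rewrite mulrC -ltr_pdivrMr// -expr_div_n.
have [x [y SE]] := lg_cylinder j k; rewrite -/w -/h in SE.
pose S (p : plane) : plane := (w * p.1 + x, h * p.2 + y).
(* Points of [E] within [e] of consecutive multiples of [e] differ in height by at most [3 * e]; the
   choice of [N] makes this at most [1 / (4 * C)]. *)
have NC : 12 * C < (Num.bound (12 * C))%:R by apply: archi_boundP; lra.
set N := Num.bound _ in NC; have N0 : 0 < N%:R :> R by lra.
pose e := N%:R^-1 : R; have e0 : 0 < e by rewrite invr_gt0.
have Ne : N%:R * e = 1 by rewrite mulfV// gt_eqF.
have eC : 3 * e <= (4 * C)^-1.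
  have C4 : 0 < 4 * C by lra.
  rewrite -(ler_pM2r C4) mulVf ?gt_eqF// -[leRHS]Ne.
  have -> : 3 * e * (4 * C) = 12 * C * e by ring.
  by rewrite ler_pM2r// ltW.
(* [r] is less than the cylinder's height, while [r / C] is twice [h / (4 * C)], a bound for both
   the width and one vertical step of the chain. *)
pose r := h / 2; have r0 : 0 < r by rewrite divr_gt0.
have rCE : r / C = 2 * (h * (4 * C)^-1) by rewrite /r; field; rewrite gt_eqF.
set u := h * (4 * C)^-1 in wh rCE.
have nearS p q : E p -> E q -> `|p.2 - q.2| <= 3 * e -> mdist (S p) (S q) < r / C.
  move=> Ep Eq pq; apply: le_lt_trans (mdist_le_add _ _) _.
  have -> : (S p).1 - (S q).1 = w * (p.1 - q.1) by rewrite /=; ring.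
  have -> : (S p).2 - (S q).2 = h * (p.2 - q.2) by rewrite /=; ring.
  rewrite !normrM (gtr0_norm w0) (gtr0_norm h0).
  have pq1 : `|p.1 - q.1| <= 1.
    have [p1 _] := lg_attractor_unit_square hdata hE Ep.
    have [q1 _] := lg_attractor_unit_square hdata hE Eq.
    by rewrite ler_norml; lra.
  have : w * `|p.1 - q.1| <= w * 1 by rewrite ler_pM2l.
  have : h * `|p.2 - q.2| <= u by rewrite ler_pM2l// (le_trans pq).
  by rewrite rCE; lra.
have dense t : 0 <= t <= 1 -> exists2 p, E p & `|p.2 - t| <= e.
  by move=> t01; apply: (lg_snd_dense hdata hE).
have [|p Ep p0] := dense 0; first by rewrite lexx ler01.
have [A [AE ballA Aball /set_dist_geP sep]] := hC _ _ (SE _ Ep) r0.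
(* A chain point outside [A] would be closer than [r / C] to its predecessor in [A]. *)
have chain l : (l <= N)%N -> forall q, E q -> `|q.2 - l%:R * e| <= e -> A (S q).
  elim: l => [_ q Eq ql|l IH lN q Eq ql].
    apply: ballA; split; last exact: SE.
    rewrite ballEmdist /=; apply: nearS => //.
    by move: ql p0; rewrite mul0r !ler_norml; lra.
  have [|q' Eq' q'l] := dense (l%:R * e).
    rewrite mulr_ge0 ?(ltW e0)//= -[leRHS]Ne ler_pM2r// ler_nat.
    exact: ltnW.
  apply: contrapT => nA.
  have := sep _ _ (IH (ltnW lN) _ Eq' q'l) (conj (SE _ Eq) nA).
  rewrite leNgt nearS//; move: ql q'l; rewrite -natr1 mulrDl mul1r !ler_norml; lra.
have [|q Eq q1] := dense 1; first by rewrite lexx ler01.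
have /Aball : A (S q) by apply: (chain N) => //; rewrite Ne.
rewrite ballEmdist /= => /(le_lt_trans (mdist_snd _ _)).
have -> : (S p).2 - (S q).2 = h * (p.2 - q.2) by rewrite /=; ring.
have e12 : 12 * e <= 1 by rewrite -[leRHS]Ne ler_pM2r//; lra.
rewrite normrM (gtr0_norm h0) /r ltr_pM2l// ltr_norml.
by move: p0 q1; rewrite subr0 !ler_norml; lra.
Qed.

End LalleyGatzourasFull.

(** * Vertical porosity and porosity along strips *)

Section LalleyGatzourasPorosity.
Context {R : realType} {m : nat} {n : 'I_m -> nat} {b : 'I_m -> R}
  {a c : forall i : 'I_m, 'I_(n i) -> R} {E : set (euclidean_plane R)}.
Hypothesis hdata : lalley_gatzouras_data b a c.
Hypothesis hE : is_attractor (lg_map b a c) E.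
Local Notation plane := (euclidean_plane R).
Local Notation d := (lg_d b).
Implicit Types (I : seq 'I_m) (p q : plane).

Let b_gt0 i : 0 < b i. Proof. by case: hdata. Qed.
Let a_gt0 i (j : 'I_(n i)) : 0 < a j.
Proof. by have [] := lg_a_bounds hdata j. Qed.

(** The empty row is a gap of the vertical projection of length at least [de]; [porous_step] copies
    it to all levels with one constant. *)
Lemma lg_vertical_gap : (exists i : 'I_m, n i = 0%N) ->
  exists k : R, [/\ 0 < k, k <= 1 & forall v r : R, 0 < r -> r <= 1 -> exists t,
    [/\ v <= t, t + k * r <= v + r & forall p, E p -> p.2 <= t \/ t + k * r <= p.2]].
Proof.
move=> [i0 ni0].
have [de [de0 de1 deb _]] := lg_width_lower_bound hdata.
have [be [be0 be1 bbe]] := lg_height_upper_bound hdata.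
pose L := de^-1; have deL : de * L = 1 by rewrite mulfV// gt_eqF.
have L1 : 1 <= L by rewrite invf_ge1.
have E01 y : (snd @` E) y -> 0 <= y <= 1.
  by move=> [p /(lg_attractor_unit_square hdata hE)[_ +] <-].
(* Each level lowers the least scale by the factor [be]; for [N = 0] it exceeds [L], so nothing is
   claimed. *)
have poroN N : porous (snd @` E) (de * de) L ((L + 1) * be ^+ N).
  elim: N => [|N]; first by move=> y r _; rewrite expr0; lra.
  apply: (@porous_step _ 'I_m b d _ _ _ _ _ _ de); rewrite ?mulr_gt0//.
  - exact: (lg_d_ge0 hdata).
  - exact: (lg_dDb_le1 hdata).
  - move=> y [p Ep <-]; have [i [j [q [Eq _ ->]]]] := lg_attractor_inv hE Ep.
    by exists i, q.2; split=> //; exists q.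
  - exact: (lg_rows_nonoverlap hdata).
  - exists (d i0), (b i0); rewrite -mulrA deL mulr1 deb addrC.
    split=> //; [exact: (lg_d_ge0 hdata)|exact: (lg_dDb_le1 hdata)|move=> y [p Ep <-]].
    have [i [j [q [Eq _ ->]]]] := lg_attractor_inv hE Ep.
    have /andP[q0 q1] : 0 <= q.2 <= 1 by have [] := lg_attractor_unit_square hdata hE Eq.
    have bi := b_gt0 i; have [ii0|h|h] := lg_rows_nonoverlap hdata i i0.
    + by move: j; rewrite ii0 ni0 => -[].
    + by left; nra.
    + by right; nra.
  - move=> i; rewrite mulrCA exprS ler_pM2l; last lra.
    by rewrite ler_wpM2r// exprn_ge0.
exists (de * de / 4); split; [nra|nra|move=> v r r0 r1].
have [||N beN] := @exists_expr_lt _ be (r / 4 / (L + 1)); first by rewrite be0.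
  by rewrite !divr_gt0//; lra.
have [|||||t [vt tv av]] := @porous_interval _ _ _ _ _ v r (poroN N).
- by nra.
- by nra.
- by [].
- by rewrite mulrC -ler_pdivlMr ?ltW//; lra.
- by lra.
- by exists t; split=> // p Ep; apply: av; exists p.
Qed.

Lemma lg_row_gaps : totally_disconnected E ->
  exists g : R, [/\ 0 < g, g <= 1 & forall i, exists t, [/\ 0 <= t, t + g <= 1
    & forall j : 'I_(n i), a j + c j <= t \/ t + g <= c j]].
Proof.
move=> tdE; have /choice[t /choice[g tg]] := fun i => lg_row_gap hdata hE i tdE.
have g0 i : 0 < g i by have [] := tg i.
have [s [s0 s1 sg]] := finite_pos_lower_bound g0.
exists s; split=> // i; exists (t i); have [_ t0 t1 tgj] := tg i.
have := sg i; split=> //; first lra.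
by move=> j; have [] := tgj j; [left|right]; lra.
Qed.

(* The union of the cylinders whose row indices form the word I. *)
Fixpoint strip I : set plane :=
  if I is i :: I' then
    [set p | exists (j : 'I_(n i)) q,
      [/\ strip I' q, p.1 = a j * q.1 + c j & p.2 = b i * q.2 + d i]]
  else E.

Definition height I : R := \prod_(i <- I) b i.

Lemma strip_sub I : strip I `<=` E.
Proof.
elim: I => [|i I IH] //= [p1 p2] [j [q [/IH Eq /= -> ->]]].
exact: (lg_attractor_map hE).
Qed.

(* The factor L + 1 makes the statement vacuous for the empty word, since
   porous only considers scales up to L. *)
Lemma strip_porous : totally_disconnected E -> exists k L : R,
  [/\ 0 < k, k <= 1, 1 <= L & forall I, porous (fst @` strip I) k L ((L + 1) * height I)].
Proof.
move=> /lg_row_gaps[g [g0 g1 gaps]].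
have [de [de0 de1 _ dea]] := lg_width_lower_bound hdata.
pose L := de^-1; have deL : de * L = 1 by rewrite mulfV// gt_eqF.
have L1 : 1 <= L by rewrite invf_ge1.
have strip01 I x : (fst @` strip I) x -> 0 <= x <= 1.
  by move=> [p /strip_sub/(lg_attractor_unit_square hdata hE)[+ _] <-].
exists (g * de), L; split=> //; [by rewrite mulr_gt0|nra|].
elim=> [|i I]; first by move=> x r _; rewrite /height big_nil; lra.
apply: (@porous_step _ 'I_(n i) (@a i) (@c i) _ _ _ _ _ _ de); rewrite ?mulr_gt0//.
- exact: (lg_c_ge0 hdata).
- exact: (lg_c_le1 hdata).
- move=> x [p [j [q [sq pE _]]] <-]; exists j, q.1.
  by split; [exists q|].
- exact: strip01.
- exact: (lg_columns_nonoverlap hdata).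
- have [t [t0 t1 tg]] := gaps i; exists t, g; rewrite -mulrA deL mulr1.
  split=> // x [p [j [q [sq pE _]]] <-].
  have /andP[q0 q1] : 0 <= q.1 <= 1 by apply: (strip01 I); exists q.
  by rewrite pE; have aj := a_gt0 j; have [] := tg j; [left|right]; nra.
(* Here [a j < b i] matters: the zoom scales lengths by [a j], the height of the word by [b i]. *)
- move=> j; rewrite mulrCA /height big_cons ler_pM2l; last lra.
  rewrite ler_wpM2r ?prodr_ge0// => [k _|]; first exact: ltW.
  by have [_ /ltW] := lg_a_bounds hdata j.
Qed.

(** * Covering thin windows by strips *)

Section Covering.
Variables de be : R.
Hypotheses (de0 : 0 < de) (deb : forall i, de <= b i)
  (be0 : 0 <= be) (bbe : forall i, b i <= be).

(** Zooming into row [i] turns [h] into [h / b i]; with [be ^+ N <= h], at most [N] zooms reach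
    scale 1, where the empty word is allowed. *)
Let scale_up i N h : be ^+ N.+1 <= h -> be ^+ N <= h / b i.
Proof.
move=> beh; rewrite ler_pdivlMr// mulrC (le_trans _ beh)// exprS.
by rewrite ler_wpM2r// exprn_ge0.
Qed.

Let height_cons i I h : height I <= h / b i -> height (i :: I) <= h.
Proof. by rewrite ler_pdivlMr// /height big_cons mulrC. Qed.

(** For [h < 1], points below [de * h] are lower than the top of the row resting on 0, so they lie
    in it; then zoom into this row. *)
Lemma bottom_strip N h : be ^+ N <= h -> exists2 I, height I <= h &
  forall p, E p -> p.2 < de * h -> strip I p.
Proof.
elim: N h => [|N IH] h beh; first by exists [::]; rewrite ?/height ?big_nil.
have [h1|h1] := leP 1 h; first by exists [::]; rewrite ?/height ?big_nil.
have [|i /andP[i0 _]] := lg_rows_cover hdata (y := 0); first by rewrite lexx ler01.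
have bi := b_gt0 i; have [I hI sI] := IH _ (scale_up i beh).
exists (i :: I); first exact: height_cons.
move=> p Ep ph; have [k [j [q [Eq p1 p2]]]] := lg_attractor_inv hE Ep.
have q0 : 0 <= q.2 by have [_ /andP[]] := lg_attractor_unit_square hdata hE Eq.
have bk := b_gt0 k; have di := lg_d_ge0 hdata i; have dk := lg_d_ge0 hdata k.
have bi1 := deb i; have dh : de * h <= de by rewrite ger_pMr// ltW.
have kq : 0 <= b k * q.2 by rewrite mulr_ge0// ltW.
have [ik|ik|ki] := lg_rows_nonoverlap hdata i k.
- subst k; exists j, q; split=> //; apply: sI => //.
  by rewrite mulrA ltr_pdivlMr//; lra.
- by exfalso; lra.
- by exfalso; lra.
Qed.

Lemma top_strip N h : be ^+ N <= h -> exists2 I, height I <= h &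
  forall p, E p -> 1 - de * h < p.2 -> strip I p.
Proof.
elim: N h => [|N IH] h beh; first by exists [::]; rewrite ?/height ?big_nil.
have [h1|h1] := leP 1 h; first by exists [::]; rewrite ?/height ?big_nil.
have [|i /andP[_ i1]] := lg_rows_cover hdata (y := 1); first by rewrite lexx ler01.
have bi := b_gt0 i; have [I hI sI] := IH _ (scale_up i beh).
exists (i :: I); first exact: height_cons.
move=> p Ep ph; have [k [j [q [Eq p1 p2]]]] := lg_attractor_inv hE Ep.
have q1 : q.2 <= 1 by have [_ /andP[]] := lg_attractor_unit_square hdata hE Eq.
have bk := b_gt0 k; have di := lg_dDb_le1 hdata i; have dk := lg_dDb_le1 hdata k.
have bi1 := deb i; have dh : de * h <= de by rewrite ger_pMr// ltW.
have kq : b k * q.2 <= b k by rewrite ger_pMr.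
have [ik|ik|ki] := lg_rows_nonoverlap hdata i k.
- subst k; exists j, q; split=> //; apply: sI => //.
  rewrite mulrA ltrBlDr -ltrBlDl ltr_pdivlMr//; lra.
- by exfalso; lra.
- by exfalso; lra.
Qed.

(* A window of height less than de * h either lies in a single row, and is then
   rescaled, or meets exactly two rows, along the top of one and the bottom of
   the other. *)
Lemma window_strips N h v : be ^+ N <= h -> exists I I',
  [/\ height I <= h, height I' <= h & forall p, E p -> v < p.2 < v + de * h ->
    strip I p \/ strip I' p].
Proof.
elim: N h v => [|N IH] h v beh.
  by exists [::], [::]; rewrite /height big_nil; split=> //; left.
have [h1|h1] := leP 1 h.
  by exists [::], [::]; rewrite /height big_nil; split=> //; left.
have h0 : 0 <= h by rewrite (le_trans _ beh)// exprn_ge0.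
pose row i p := exists (j : 'I_(n i)) q,
  [/\ E q, p.1 = a j * q.1 + c j & p.2 = b i * q.2 + d i].
have inrow p : E p -> exists i, row i p.
  by move=> /(lg_attractor_inv hE)[i [j [q [? ? ?]]]]; exists i, j, q.
have row_bounds i p : row i p -> d i <= p.2 <= b i + d i.
  move=> [j [q [Eq _ ->]]]; have bi := b_gt0 i.
  have /andP[q0 q1] : 0 <= q.2 <= 1 by have [] := lg_attractor_unit_square hdata hE Eq.
  by apply/andP; split; nra.
have dh : de * h <= de by rewrite ger_pMr// ltW.
pose win p := v < p.2 < v + de * h.
(* If the window meets rows [k] and [l], a third row would force it to span a whole row, but its
   height is at most [de]. *)
have [[k [l [p [q [[kl rk rl] /andP[vp pv] /andP[vq qv]]]]]]|nsplit] := pselect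
    (exists k l p q, [/\ [/\ b k + d k <= d l, row k p & row l q], win p & win q]).
  have /andP[kp pk] := row_bounds _ _ rk; have /andP[lq ql] := row_bounds _ _ rl.
  have bk := b_gt0 k; have bl := b_gt0 l; have dek := deb k; have del := deb l.
  have [I hI sI] := top_strip (scale_up k beh).
  have [I' hI' sI'] := bottom_strip (scale_up l beh).
  exists (k :: I), (l :: I'); split; [exact: height_cons|exact: height_cons|].
  move=> z Ez /andP[vz zv]; have [t rt] := inrow z Ez.
  have /andP[tz zt] := row_bounds _ _ rt.
  have [tk|tk|kt] := lg_rows_nonoverlap hdata t k.
  - subst t; left; have [j [w [Ew z1 z2]]] := rt; exists j, w; split=> //.
    apply: sI => //; rewrite mulrA ltrBlDr -ltrBlDl ltr_pdivlMr//; lra.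
  - by exfalso; have := deb t; lra.
  - have [tl|tl|lt] := lg_rows_nonoverlap hdata t l.
    + subst t; right; have [j [w [Ew z1 z2]]] := rt; exists j, w; split=> //.
      apply: sI' => //; rewrite mulrA ltr_pdivlMr//; lra.
    + by exfalso; have := deb t; lra.
    + by exfalso; have := deb t; lra.
have [k onerow] : exists k, forall p i, win p -> row i p -> i = k.
  have [[p [k [wp rp]]]|none] := pselect (exists p k, win p /\ row k p); last first.
    exists (Ordinal (ltnW (lg_m_ge2 hdata))) => p i wp rp.
    by case: none; exists p, i.
  exists k => q i wq rq; have [//|ik|ki] := lg_rows_nonoverlap hdata i k.
  - by case: nsplit; exists i, k, q, p.
  - by case: nsplit; exists k, i, p, q.
have bk := b_gt0 k; have [I [I' [hI hI' sI]]] := IH _ ((v - d k) / b k) (scale_up k beh).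
exists (k :: I), (k :: I'); split; [exact: height_cons|exact: height_cons|].
move=> p Ep wp; have [i rp] := inrow p Ep; have ik := onerow _ _ wp rp; subst i.
have [j [q [Eq p1 p2]]] := rp; move: wp => /andP[vp pv].
have [] := sI q Eq; last 2 first.
- by move=> sq; left; exists j, q.
- by move=> sq; right; exists j, q.
have -> : (v - d k) / b k + de * (h / b k) = (v - d k + de * h) / b k.
  by field; rewrite gt_eqF.
by rewrite ltr_pdivrMr// ltr_pdivlMr//; apply/andP; split; lra.
Qed.

End Covering.

(* Two strips suffice to cover the window, and a gap of the second one is taken
   inside a gap of the first one. *)
Lemma lg_horizontal_gap : totally_disconnected E ->
  exists k th : R, [/\ 0 < k, k <= 1, 0 < th, th <= 1 &
    forall u v r : R, 0 < r -> r <= 1 -> exists t, [/\ u <= t, t + k * r <= u + r &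
      forall p, E p -> v < p.2 < v + th * r -> p.1 <= t \/ t + k * r <= p.1]].
Proof.
move=> /strip_porous[k [L [k0 k1 L1 poro]]].
have [de [de0 de1 deb _]] := lg_width_lower_bound hdata.
have [be [be0 be1 bbe]] := lg_height_upper_bound hdata.
(* Strips of height at most [s * r] are porous down to [k / 16 * r], a quarter of the length of the
   first gap, where the second gap is sought. *)
pose s := k / (16 * (L + 1)).
have Lp : 0 < 16 * (L + 1) by lra.
have s0 : 0 < s by rewrite divr_gt0.
have sE : (L + 1) * s = k / 16 by rewrite /s; field; rewrite gt_eqF//; lra.
have s1 : s <= 1 by nra.
exists (k / 4 * (k / 4)), (de * s); split; [nra|nra|nra|nra|].
move=> u v r r0 r1; have sr0 : 0 < s * r by rewrite mulr_gt0.
have [|N /ltW beN] := @exists_expr_lt _ be (s * r) _ sr0; first by rewrite be0.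
have [I [I' [hI hI' cov]]] := window_strips de0 deb be0 bbe v beN.
have scale J : height J <= s * r -> (L + 1) * height J <= k / 16 * r.
  by move=> hJ; rewrite -sE -mulrA ler_pM2l//; lra.
have kr : k * r <= r by nra.
have [|||||t1 [ut1 t1u av1]] := @porous_interval _ _ _ _ _ u r (poro I) => //.
- by rewrite (le_trans (scale _ hI))//; lra.
- by lra.
have r'0 : 0 < k / 4 * r by nra.
have [|||||t [t1t tt1 av]] := @porous_interval _ _ _ _ _ t1 (k / 4 * r) (poro I') => //.
- by rewrite (le_trans (scale _ hI'))//; lra.
- by lra.
exists t; have -> : k / 4 * (k / 4) * r = k / 4 * (k / 4 * r) by ring.
split; [lra|lra|move=> p Ep]; rewrite -(mulrA de) => win; have [sp|sp] := cov p Ep win.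
  by have [||] := av1 p.1; [exists p|left; lra|right; lra].
by apply: av; exists p.
Qed.

End LalleyGatzourasPorosity.

(** * The equivalence, by cutting out a box *)

Theorem theorem1p1 (R : realType) (m : nat) (n : 'I_m -> nat) (b : 'I_m -> R)
    (a c : forall i : 'I_m, 'I_(n i) -> R) (E : set (euclidean_plane R))
    (hdata : lalley_gatzouras_data b a c)
    (hE : is_attractor (lg_map b a c) E) :
  uniformly_disconnected E <->
    (totally_disconnected E /\ exists i : 'I_m, n i = 0%N).
Proof.
split=> [udE|[tdE n0]].
  split; first exact: uniformly_disconnected_totally_disconnected.
  exact: (uniformly_disconnected_empty_row hdata hE).
have [k [th [k0 k1 th0 th1 hgap]]] := lg_horizontal_gap hdata hE tdE.
have [l [l0 l1 vgap]] := lg_vertical_gap hdata hE n0.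
have kl0 : 0 < k * l by rewrite mulr_gt0.
have kl_k : k * l <= k by rewrite ger_pMr.
have kl_l : k * l <= l by rewrite ger_pMl.
(* Chosen so that [s * r / 16] is at most every gap length, [k * (r / 4)] and [l * (q / 4)], and at
   most [q / 4], with [q] as below. *)
pose s := k * l * th; have s0 : 0 < s by rewrite mulr_gt0.
have s_k : s <= k by rewrite (le_trans _ kl_k)// /s ger_pMr.
have s_lth : s <= l * th by rewrite ler_pM2r.
have s_th : s <= th by rewrite /s ger_pMl//; lra.
exists (16 / s); first by rewrite ltr_pdivlMr//; lra.
move=> xi r Exi r0; have rCE : r / (16 / s) = s * r / 16.
  by field; rewrite gt_eqF.
(* For [r > 2] the whole of [E], inside the unit square, serves as [A]; otherwise [r / 4 <= 1] and
   the gap lemmas apply. *)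
have [r2|r2] := ltP 2 r.
  exists E; split; [by []|by move=> p []|move=> p Ep|].
    rewrite ballEmdist /=; apply: le_lt_trans (mdist_le_add _ _) (le_lt_trans _ r2).
    have [x1 x2] := lg_attractor_unit_square hdata hE Exi.
    have [p1 p2] := lg_attractor_unit_square hdata hE Ep.
    by apply: (@le_trans _ _ (1 + 1)); [apply: lerD; rewrite ler_norml; lra|lra].
  by apply/set_dist_geP => x y _ [Ey /(_ Ey)].
have r4 : 0 < r / 4 by lra.
have r41 : r / 4 <= 1 by lra.
(* Left and right gaps at distance [r / 4] to [r / 2] from [xi], valid in a band of height
   [th * (r / 4)] centred at [xi]. *)
have [tL [uL Lu gL]] := hgap (xi.1 - r / 2) (xi.2 - th * (r / 4) / 2) _ r4 r41.
have [tR [uR Ru gR]] := hgap (xi.1 + r / 4) (xi.2 - th * (r / 4) / 2) _ r4 r41.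
set q := th * (r / 4) in gL gR.
have q0 : 0 < q by rewrite mulr_gt0// divr_gt0.
have q1 : q <= r / 4 by rewrite /q ger_pMl//; lra.
have q4 : 0 < q / 4 by lra.
have q41 : q / 4 <= 1 by lra.
have [tB [vB Bv gB]] := vgap (xi.2 - q / 2) _ q4 q41.
have [tT [vT Tv gT]] := vgap (xi.2 + q / 4) _ q4 q41.
have g1 : 0 < k * (r / 4) by rewrite mulr_gt0// divr_gt0.
have g2 : 0 < l * (q / 4) by rewrite mulr_gt0// divr_gt0.
have gap1 : s * r / 16 <= k * (r / 4).
  have : s * r <= k * r by rewrite ler_pM2r.
  lra.
have gap2 : s * r / 16 <= l * (q / 4).
  have : s * r <= l * th * r by rewrite ler_pM2r.
  have -> : l * (q / 4) = l * th * r / 16 by rewrite /q; field.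
  lra.
have small : s * r / 16 <= q / 4.
  have : s * r <= th * r by rewrite ler_pM2r.
  have -> : q / 4 = th * r / 16 by rewrite /q; field.
  lra.
(* [A] is bounded by the outer ends of the four gaps, its points by the inner ends, see [inside]. *)
pose A := [set p : euclidean_plane R |
  [/\ E p, tL < p.1 < tR + k * (r / 4) & tB < p.2 < tT + l * (q / 4)]].
have inside p : A p ->
    tL + k * (r / 4) <= p.1 <= tR /\ tB + l * (q / 4) <= p.2 <= tT.
  move=> [Ep /andP[Lp pR] /andP[Bp pT]].
  (* Vertical gaps come first: they put [p] in the band where the horizontal ones are valid. *)
  have pB : tB + l * (q / 4) <= p.2 by have [] := gB p Ep; lra.
  have pT' : p.2 <= tT by have [] := gT p Ep; lra.
  have win : xi.2 - q / 2 < p.2 < xi.2 - q / 2 + q by lra.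
  have pL : tL + k * (r / 4) <= p.1 by have [] := gL p Ep win; lra.
  have pR' : p.1 <= tR by have [] := gR p Ep win; lra.
  by split; apply/andP.
exists A; rewrite rCE; split.
- by move=> p [].
- move=> p [+ Ep]; rewrite ballEmdist /= => xip.
  have := le_lt_trans (mdist_fst _ _) xip; have := le_lt_trans (mdist_snd _ _) xip.
  rewrite !ltr_norml => /andP[y1 y2] /andP[x1 x2].
  by split=> //; apply/andP; split; lra.
- move=> p /inside[/andP[x1 x2] /andP[y1 y2]]; rewrite ballEmdist /=.
  apply: le_lt_trans (mdist_le_add _ _) _.
  have : `|xi.1 - p.1| <= r / 2 by rewrite ler_norml; lra.
  have : `|xi.2 - p.2| <= q / 2 by rewrite ler_norml; lra.
  by lra.
(* Every gap is at least [s * r / 16] long, so a point of [E] closer than this to [p] would be in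
   the box. *)
- apply/set_dist_geP => p z Ap [Ez nAz]; rewrite leNgt; apply/negP => pz.
  have := le_lt_trans (mdist_fst _ _) pz; have := le_lt_trans (mdist_snd _ _) pz.
  rewrite !ltr_norml => /andP[y1 y2] /andP[x1 x2].
  have [/andP[x3 x4] /andP[y3 y4]] := inside p Ap.
  by apply: nAz; split=> //; apply/andP; split; lra.
Qed.
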